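(* Let $m\ge 1$ and let $\mathcal P=(\mathcal C,\mathcal A)$ be an $m$-color palette satisfying $\mathcal P_L\not\preceq\mathcal P$ and $\mathcal P_R\not\preceq\mathcal P$. Then $|\mathcal A|=\frac{m(m^2-1)}3$ if and only if $\mathcal P=\mathcal P_m^\star(J)$ for some ordered digon chain $J$ on $\mathcal C$. Consequently, up to a relabeling of the colors, $\mathcal P_m^\star$ is the unique extremal palette (i.e. the unique $m$-color palette avoiding $\mathcal P_L$ and $\mathcal P_R$ with the maximum number $\frac{m(m^2-1)}{3}$ of admissible triples).
   Context: A palette is a pair $\mathcal P=(\mathcal C,\mathcal A)$ where $\mathcal C$ is a finite set of colors and $\mathcal A\subseteq\mathcal C^3$ (repeated colors allowed); it is an $m$-color palette if $|\mathcal C|=m$. A homomorphism of palettes is a map between color sets sending admissible triples (coordinatewise) to admissible triples; write $\mathcal P\preceq\mathcal P'$ if a homomorphism $\mathcal P\to\mathcal P'$ exists, and $\mathcal P\not\preceq\mathcal P'$ otherwise. Let $\overrightarrow C_3$ be the directed triangle, with vertex set $V$ and arc set $A$, and let $\mathcal C_0=V\sqcup\{c_{uv}:uv\in A\}$ with $c_{uv}$ new distinct colors. Put $\mathcal P_L=(\mathcal C_0,\{(u,v,c_{uv}):uv\in A\})$ and $\mathcal P_R=(\mathcal C_0,\{(c_{uv},u,v):uv\in A\})$. An ordered digon chain on an $m$-element set is a digraph obtained from a linear ordering of the set by splitting it into consecutive blocks of size $2$ (with a final block of size $1$ if $m$ is odd), putting both arcs between the two vertices of each 2-element block, and putting, for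 every pair of vertices in different blocks, exactly the one arc from the vertex of the earlier block to the vertex of the later block. $\overrightarrow{\mathcal F}_{m,2}$ denotes the ordered digon chain on the standard ordered set of $m$ elements. For an ordered digon chain $J$ on a color set $\mathcal C$ with $|\mathcal C|=m$, $\mathcal P_m^\star(J)$ is the palette with color set $\mathcal C$ in which $(x,y,z)$ is admissible iff $yx$ and $yz$ are both arcs of $J$ ($x=z$ allowed). $\mathcal P_m^\star=\mathcal P_m^\star(\overrightarrow{\mathcal F}_{m,2})$. *)

(* Defs.v *)
From mathcomp Require Import all_boot.

Set Implicit Arguments.
Unset Strict Implicit.
Unset Printing Implicit Defensive.

(* A palette with color set C is identified with its set of admissible
   triples; (x, y, z) is the left-nested pair ((x, y), z). *)
Notation palette C := {set C * C * C}.

Definition palette_hom (C C' : finType) (P : palette C) (P' : palette C')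
    (f : C -> C') : Prop :=
  forall x y z, (x, y, z) \in P -> (f x, f y, f z) \in P'.

Definition palette_le (C C' : finType) (P : palette C) (P' : palette C') : Prop :=
  exists f : C -> C', palette_hom P P' f.

(* A bijection carrying the admissible triples exactly onto the admissible
   triples: both palettes are the same up to relabeling the colors. *)
Definition palette_iso (C C' : finType) (P : palette C) (P' : palette C') : Prop :=
  exists2 f : C -> C', bijective f &
    forall x y z, ((x, y, z) \in P) = ((f x, f y, f z) \in P').

(* The directed triangle 0 -> 1 -> 2 -> 0 ([ordS] is the cyclic successor). *)
Definition C3_arc : rel 'I_3 := fun u v => v == ordS u.

Definition C3_arcs : finType := {a : 'I_3 * 'I_3 | C3_arc a.1 a.2}.

(* [inr a] is the new color c_{uv} attached to the arc a = uv. *)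
Definition C0 : finType := ('I_3 + C3_arcs)%type.

Definition P_L : palette C0 :=
  [set (inl (val a).1, inl (val a).2, inr a) | a : C3_arcs].

Definition P_R : palette C0 :=
  [set (inr a, inl (val a).1, inl (val a).2) | a : C3_arcs].

Definition linear_order (C : finType) (le : rel C) : Prop :=
  [/\ reflexive le, antisymmetric le, transitive le & total le].

(* The number of predecessors of x is its 0-based position in the ordering, and
   halving it gives the index of the block containing x: positions 2k and 2k+1
   form block k, the last block being a singleton when #|C| is odd. *)
Definition block (C : finType) (le : rel C) (x : C) : nat :=
  #|[set y | (y != x) && le y x]|./2.

Definition digon_chain (C : finType) (le : rel C) : rel C := fun x y =>
  ((x != y) && (block le x == block le y)) || (block le x < block le y).

Definition ordered_digon_chain (C : finType) (J : rel C) : Prop :=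
  exists2 le : rel C, linear_order le & J =2 digon_chain le.

Definition F2 (m : nat) : rel 'I_m :=
  digon_chain (fun i j : 'I_m => i <= j).

Definition Pstar (C : finType) (J : rel C) : palette C :=
  [set t : C * C * C | let: (x, y, z) := t in J y x && J y z].

Definition Pmstar (m : nat) : palette 'I_m := Pstar (@F2 m).

Definition avoids_LR (C : finType) (P : palette C) : Prop :=
  ~ palette_le P_L P /\ ~ palette_le P_R P.

Definition extremal (m : nat) (C : finType) (P : palette C) : Prop :=
  [/\ #|C| = m, avoids_LR P &
      forall (C' : finType) (P' : palette C'),
        #|C'| = m -> avoids_LR P' -> #|P'| <= #|P|].

(* m (m^2 - 1) / 3; the truncated operations of nat are harmless: the
   subtraction does not truncate for m >= 1, and the division is exact by
   [dvdn3_extremal]. *)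
Definition extremal_number (m : nat) : nat := (m * (m ^ 2 - 1)) %/ 3.

Lemma dvdn3_extremal (m : nat) : 3 %| m * (m ^ 2 - 1).
Proof.
case: m => // n.
have -> : n.+1 ^ 2 - 1 = n * n.+2 by rewrite -mulnn mulSn addSn subn1 -mulnS.
rewrite !Euclid_dvdM // /dvdn -(addn2 n) -(addn1 n) -(modnDml n 1) -(modnDml n 2).
by have: n %% 3 < 3 by [rewrite ltn_mod]; case: (n %% 3) => [|[|[|]]].
Qed.

(* Main.v *)
(** Write [L y x] (resp. [R y x]) if some admissible triple starts with [(x, y)]
    (resp. ends with [(y, x)]).  Avoiding [P_L] and [P_R] means that the digraphs
    [L] and [R] have no closed walk of length 3, and each middle color [y] carries
    at most [d_L y * d_R y] triples, so by AM-GM it is enough to bound the sum of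
    the squared out-degrees [d] of a single such digraph on [m] vertices.

    A set of [k] vertices spans at most [k^2/2] arcs, so for every threshold [t]
    the [k] vertices of out-degree [> t] satisfy
    [sum (d - t) <= k^2/2 + k (m - k) - k t <= (m - t)^2/2].  Since
    [d^2 = d + 2 * sum_(t >= 1) (d - t)^+], summing over [t] yields the bound
    [m (m^2 - 1) / 3].  In the case of equality all thresholds are tight: this
    determines the number of vertices of each out-degree and forces all arcs from
    [d > t] to [d <= t]; the absence of triangles then forces the digraph to be
    [x -> y] iff [x != y] and [d y <= d x], an ordered digon chain determined by
    its out-degrees, whence [L = R]. *)
Require Import Defs.
From mathcomp Require Import all_boot zify.

Set Implicit Arguments.
Unset Strict Implicit.
Unset Printing Implicit Defensive.

(** * Preliminaries on sums and the extremal number *)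

Definition triangle_free (C : finType) (e : rel C) : Prop :=
  forall x y z, e x y -> e y z -> e z x -> False.

Definition outdeg (C : finType) (e : rel C) (x : C) : nat := #|[set y | e x y]|.

Lemma card_bool_sum (C : finType) (Q : pred C) :
  #|[set x | Q x]| = \sum_x Q x.
Proof.
by rewrite -sum1dep_card big_mkcond; apply: eq_bigr => x _; case: (Q x).
Qed.

Lemma sum_leq_eq (I : finType) (F G : I -> nat) :
  (forall i, F i <= G i) -> \sum_i G i <= \sum_i F i -> forall i, F i = G i.
Proof.
move=> FG GF i; apply/eqP.
have := leqif_sum (fun j (_ : true) => leqif_eq (FG j)).
by case=> H; rewrite eqn_leq H GF => /esym/forallP/(_ i).
Qed.

(** The sum is a(a-1)/2, since truncation kills the terms with [a <= t.+1]; so one range [m] serves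
    all vertices. *)
Lemma sqr_eq_sum_sub m a : a <= m -> a ^ 2 = a + 2 * \sum_(t < m) (a - t.+1).
Proof.
elim: m a => [|m IHm] [|a] // am; first by rewrite big_ord0.
  by rewrite big1.
rewrite big_ord_recl /= subn1 /=.
under eq_bigr => t _ do rewrite /bump /= add1n subSS.
have := IHm a am; move: (\sum_(_ < _) _) => s; rewrite -!mulnn; nia.
Qed.

Lemma extremal_numberE m : extremal_number m =
  (m ^ 2)./2 + 2 * \sum_(t < m) ((m - t.+1) ^ 2)./2.
Proof.
apply/eqP; rewrite -(eqn_pmul2r (isT : 0 < 3)) /extremal_number.
rewrite divnK ?dvdn3_extremal //; apply/eqP.
elim: m => [|m IHm]; first by rewrite big_ord0.
rewrite big_ord_recl /= subn1 /=.
under eq_bigr => t _ do rewrite /bump /= add1n subSS.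
move: (\sum_(_ < _) _) IHm => s; rewrite -!mulnn => IHm.
(* Consecutive halved squares add up to m^2 + m, which is the increment of the extremal number. *)
have : 2 * (m.+1 * m.+1)./2 + 2 * (m * m)./2 = 2 * (m * m) + 2 * m.
  by rewrite -(odd_double_half m); case: (odd m); move: (m./2) => k; nia.
have : m * (m * m - 1) + m = m * m * m by rewrite mulnBr; nia.
have : m.+1 * (m.+1 * m.+1 - 1) = m * m * m + 3 * (m * m) + 2 * m.
  by rewrite mulnBr; nia.
lia.
Qed.

(** * Squared out-degrees of triangle-free digraphs *)

Section TriangleFree.

Variables (C : finType) (e : rel C).
Hypothesis e_free : triangle_free e.

Lemma triangle_free_irr x : e x x = false.
Proof. by apply/negP => exx; exact: (e_free exx exx exx). Qed.

(** Induction removing a digon: with k = #|S|, (k-2)^2/2 + 2(k-2) + 2 = k^2/2. Without digons, each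
    ordered pair and its reverse carry at most one arc together. *)
Lemma arcs_le_half_square (S : {set C}) :
  2 * (\sum_(x in S) \sum_(y in S) e x y) <= #|S| ^ 2.
Proof.
have [n] := ubnP #|S|; elim: n S => // n IHn S ltSn.
have [/existsP[[x y] /= /and4P[xS yS exy eyx]]|/existsPn noDigon] :=
  boolP [exists p : C * C, [&& p.1 \in S, p.2 \in S, e p.1 p.2 & e p.2 p.1]].
- have xy : y != x by apply: contraL exy => /eqP ->; rewrite triangle_free_irr.
  have yS' : y \in S :\ x by rewrite !inE xy.
  have split_sum (F : C -> nat) :
      \sum_(z in S) F z = F x + (F y + \sum_(z in S :\ x :\ y) F z).
    by rewrite (big_setD1 x xS) (big_setD1 y yS').
  have cS : #|S| = (#|S :\ x :\ y|).+2 by rewrite (cardsD1 x) xS (cardsD1 y) yS'.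
  have /(IHn (S :\ x :\ y)) IH : #|S :\ x :\ y| < n by lia.
  (* Since x and y form a digon, a path x, w, y or y, w, x would close to a triangle; so w has at
     most two arcs to or from {x, y}. *)
  have cross : \sum_(w in S :\ x :\ y) (e x w + e y w + e w x + e w y)
      <= \sum_(w in S :\ x :\ y) 2.
    apply: leq_sum => w _.
    have h1 : ~~ (e x w && e w y).
      by apply/negP => /andP[xw wy]; exact: (e_free xw wy eyx).
    have h2 : ~~ (e y w && e w x).
      by apply/negP => /andP[yw wx]; exact: (e_free yw wx exy).
    by move: h1 h2; case: (e x w); case: (e y w); case: (e w x); case: (e w y).
  rewrite split_sum !split_sum !triangle_free_irr exy eyx.
  under [X in _ + (_ + X)]eq_bigr => w _ do rewrite split_sum.
  rewrite sum_nat_const in cross.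
  rewrite !big_split /= in cross *.
  rewrite cS; nia.
- rewrite mul2n -addnn {2}exchange_big -big_split /=.
  rewrite -mulnn -sum_nat_const; apply: leq_sum => x xS.
  rewrite -big_split -sum1_card; apply: leq_sum => y yS /=.
  by have := noDigon (x, y); rewrite /= xS yS; case: (e x y); case: (e y x).
Qed.

Let d := outdeg e.

Let excess t := \sum_x (d x - t).

Lemma outdeg_lt x : d x < #|C|.
Proof.
rewrite -cardsT; apply: proper_card; apply/properP; split; first exact: subsetT.
by exists x; rewrite !inE // triangle_free_irr.
Qed.

(* The last sum counts the missing arcs from [d > t] to its complement. *)
Lemma excess_bound t : t <= #|C| ->
  2 * (excess t + \sum_(x | t < d x) \sum_(y | d y <= t) ~~ e x y)
    <= (#|C| - t) ^ 2.
Proof.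
move=> tm; set S := [set x | t < d x].
have Ed : excess t + #|S| * t = \sum_(x in S) d x.
  rewrite /excess (bigID (mem S)) /= [X in _ + X + _]big1 => [|x]; last first.
    by rewrite !inE; lia.
  rewrite addn0 -sum_nat_const -big_split /=; apply: eq_bigr => x.
  by rewrite !inE; lia.
have cC : #|S| + #|~: S| = #|C| by rewrite cardsC.
(* Arcs out of [S] stay inside or reach the complement; adding the missing ones completes all pairs
   in [S] times [~: S]. *)
have Sd : \sum_(x in S) d x
    + \sum_(x | t < d x) \sum_(y | d y <= t) ~~ e x y =
    \sum_(x in S) \sum_(y in S) e x y + #|S| * #|~: S|.
  rewrite -sum_nat_const.
  have -> : \sum_(x | t < d x) \sum_(y | d y <= t) ~~ e x y =
      \sum_(x in S) \sum_(y in ~: S) ~~ e x y.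
    apply: eq_big => x; rewrite ?inE // => _.
    by apply: eq_bigl => y; rewrite !inE leqNgt.
  rewrite -!big_split; apply: eq_bigr => x _ /=.
  rewrite /d /outdeg card_bool_sum (bigID (mem S)) /= -addnA; congr (_ + _).
  rewrite -sum1_card (eq_bigl (mem (~: S))); last by move=> y; rewrite !inE.
  by rewrite -big_split; apply: eq_bigr => y _ /=; case: (e x y).
have := arcs_le_half_square S.
move: (\sum_(x in S) \sum_(y in S) _) Sd => E Sd.
rewrite -!mulnn.
have [n mE] : exists n, #|C| = t + n by exists (#|C| - t); rewrite subnKC.
rewrite mE addKn in cC *.
move: (\sum_(x | t < d x) _) (\sum_(x in S) d x) Sd Ed => G D.
move: #|S| #|~: S| cC => k c kc Sd Ed Ek.
have : k * k + k * c = k * t + k * n by rewrite -!mulnDr kc.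
(* With k + c = t + n, the left side is at most k^2 + 2k(c - t) = 2kn - k^2, hence at most n^2. *)
have [AG _] := nat_Cauchy k n; rewrite -!mulnn in AG.
lia.
Qed.

Lemma excess_le t : t <= #|C| -> excess t <= ((#|C| - t) ^ 2)./2.
Proof. by move=> /excess_bound; lia. Qed.

Lemma sum_outdeg_sq :
  \sum_x d x ^ 2 = excess 0 + 2 * \sum_(t < #|C|) excess t.+1.
Proof.
rewrite exchange_big big_distrr -big_split /=; apply: eq_bigr => x _.
by rewrite subn0 -sqr_eq_sum_sub // ltnW // outdeg_lt.
Qed.

Lemma sum_outdeg_sq_le : \sum_x d x ^ 2 <= extremal_number #|C|.
Proof.
rewrite sum_outdeg_sq extremal_numberE leq_add //.
  by rewrite -[X in X ^ 2]subn0 excess_le.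
by rewrite leq_mul2l leq_sum // => t _; rewrite excess_le.
Qed.

(** * The equality case *)

Section Extremal.

Hypothesis sum_d : \sum_x d x ^ 2 = extremal_number #|C|.

Lemma excess_extremal t : t <= #|C| -> excess t = ((#|C| - t) ^ 2)./2.
Proof.
have W0 := excess_le (leq0n _); rewrite subn0 in W0.
have WS (t : 'I_#|C|) := excess_le (ltn_ord t).
have WS_sum : \sum_(t < #|C|) excess t.+1
    <= \sum_(t < #|C|) ((#|C| - t.+1) ^ 2)./2 by apply: leq_sum => i _.
move: sum_d; rewrite sum_outdeg_sq extremal_numberE => E.
case: t => [_|t tm]; first by rewrite subn0; lia.
have tight : \sum_(i < #|C|) ((#|C| - i.+1) ^ 2)./2
    <= \sum_(i < #|C|) excess i.+1 by lia.
exact: (sum_leq_eq WS tight (Ordinal tm)).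
Qed.

(** The count is the difference of the excesses at [t] and [t.+1], both known exactly. *)
Lemma card_outdeg_gt t : #|[set x | t < d x]| = 2 * (#|C| - t)./2.
Proof.
have [tm|mt] := ltnP t #|C|; last first.
  rewrite (eqP mt) muln0; apply: eq_card0 => x.
  by rewrite !inE; have := outdeg_lt x; lia.
have E : excess t = #|[set x | t < d x]| + excess t.+1.
  by rewrite card_bool_sum -big_split; apply: eq_bigr => x _ /=; lia.
have := excess_extremal (ltnW tm); have := excess_extremal tm.
have [n ->] : exists n, #|C| = t + n.+1.
  by exists (#|C| - t.+1); rewrite -addSnnS subnKC.
rewrite addKn addnS subSS addKn -!mulnn => WS Wt.
move: E; rewrite {}WS {}Wt -(odd_double_half n).
by case: (odd n); move: (n./2) => k; lia.
Qed.

Lemma card_outdeg_eq t :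
  #|[set x | d x == t]| + 2 * (#|C| - t)./2 =
  if t is t'.+1 then 2 * (#|C| - t')./2 else #|C|.
Proof.
rewrite -card_outdeg_gt !card_bool_sum -big_split /=.
case: t => [|t]; first by rewrite -sum1_card; apply: eq_bigr => x _; lia.
by rewrite -card_outdeg_gt card_bool_sum; apply: eq_bigr => x _; lia.
Qed.

Lemma arc_down x y : d y < d x -> e x y.
Proof.
move=> yx; apply/negPn/negP => Nexy.
(* At threshold [d y] the excess is already the rounded-down half square, so one missing arc breaks
   the bound. *)
have := excess_bound (ltnW (outdeg_lt y)).
rewrite (excess_extremal (ltnW (outdeg_lt y))) (bigD1 x) //= (bigD1 y) //= Nexy.
lia.
Qed.

(** Let d x = t + 1. A nonempty level t + 1 forces #|C| - t to be even, so only t vertices have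
    smaller out-degree: too few for all out-neighbors of [x]. *)
Lemma arc_not_down x : 0 < d x -> exists2 y, d x <= d y & e x y.
Proof.
case dxE: (d x) => [//|t] _.
have [/existsP[y /andP[]]|/existsPn noArc] :=
  boolP [exists y, (t < d y) && e x y]; first by exists y.
have : d x <= #|~: [set y | t < d y]|.
  apply/subset_leq_card/subsetP => y; rewrite !inE => exy.
  by have := noArc y; rewrite exy andbT.
have := cardsC [set y | t < d y]; rewrite card_outdeg_gt dxE.
have := card_outdeg_eq t.+1.
have : 0 < #|[set y | d y == t.+1]| by apply/card_gt0P; exists x; rewrite inE dxE.
by have := outdeg_lt x; rewrite dxE; lia.
Qed.

(** An arc up to [y] extends to some [z] at least as high as [y], and [arc_down] closes the
    triangle. *)
Lemma no_arc_up x y : d x < d y -> e x y = false.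
Proof.
move=> xy; apply/negP => exy.
have [z yz eyz] := arc_not_down (leq_ltn_trans (leq0n _) xy).
exact: (e_free exy eyz (arc_down (leq_trans xy yz))).
Qed.

(** Positive levels have 0 or 2 vertices; level 0 has one exactly when #|C| is odd. *)
Lemma card_outdeg_eq_le t : #|[set x | d x == t]| <= (t != 0).+1.
Proof. by have := card_outdeg_eq t; case: t => [|t] /=; lia. Qed.

Lemma arcE x y : e x y = (x != y) && (d y <= d x).
Proof.
have [<-|xy] := eqVneq x y; first by rewrite triangle_free_irr.
have [lt_xy|] := ltnP (d x) (d y); first by rewrite no_arc_up.
rewrite leq_eqVlt => /orP[/eqP dxy|/arc_down //].
have xy_level : [set x; y] \subset [set z | d z == d x].
  by apply/subsetP => z; rewrite !inE => /orP[] /eqP ->; rewrite ?dxy.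
have dx0 : 0 < d x.
  have := leq_trans (subset_leq_card xy_level) (card_outdeg_eq_le _).
  by rewrite cards2 xy lt0n; case: (d x != 0).
(* This [z] lies in the level of [x]; if it were not [y], that level would have three vertices. *)
have [z dz exz] := arc_not_down dx0.
have zx : z != x by apply: contraTneq exz => ->; rewrite triangle_free_irr.
apply: contraT => Nexy.
have zy : z != y by apply: contraNneq Nexy => <-.
have {}dz : d z == d x.
  by rewrite eqn_leq dz andbT leqNgt; apply: contraL exz => /no_arc_up ->.
have : z |: [set x; y] \subset [set z | d z == d x].
  by rewrite subUset sub1set inE dz.
move/subset_leq_card; rewrite cardsU1 cards2 !inE negb_or zx zy xy.
by have := card_outdeg_eq_le (d x); case: (_ != 0); lia.
Qed.

Lemma extremal_digon_chain : ordered_digon_chain e.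
Proof.
(* Decreasing out-degree, with ties broken by the enumeration of [C]. *)
pose le x y := (d y < d x) || ((d x == d y) && (enum_rank x <= enum_rank y)).
exists le.
  split.
  - by move=> x; rewrite /le eqxx leqnn orbT.
  - move=> x y xy; apply/enum_rank_inj/val_inj.
    by apply: (_ : enum_rank x = enum_rank y :> nat); move: xy; rewrite /le; lia.
  - by move=> y x z; rewrite /le; lia.
  - by move=> x y; rewrite /le; lia.
(* The predecessors are an even number of vertices of larger out-degree plus at most one tie, which
   halving absorbs. *)
have blockE x : block le x = (#|C| - d x)./2.
  have U : [set y | (y != x) && le y x] =
      [set y | d x < d y]
      :|: [set y | [&& y != x, d y == d x & enum_rank y <= enum_rank x]].
    apply/setP => y; rewrite !inE /le.
    by have [->|] := eqVneq y x; rewrite ?ltnn //= andbT.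
  have level :
      #|[set y | [&& y != x, d y == d x & enum_rank y <= enum_rank x]]| <= 1.
    rewrite -ltnS; apply: leq_trans (_ : #|[set y | d y == d x]| <= 2); last first.
      by have := card_outdeg_eq_le (d x); case: (_ != 0); lia.
    rewrite (cardsD1 x [set y | d y == d x]) inE eqxx ltnS.
    by apply/subset_leq_card/subsetP => y; rewrite !inE => /and3P[-> -> _].
  rewrite /block U cardsU (_ : _ :&: _ = set0); last first.
    by apply/setP => y; rewrite !inE; lia.
  by rewrite cards0 subn0 card_outdeg_gt; lia.
have block_lt x y : d y < d x -> block le x < block le y.
  move=> yx; rewrite !blockE.
  suff : #|[set z | d x < d z]| < #|[set z | d y < d z]|.
    by rewrite !card_outdeg_gt; lia.
  apply: proper_card; apply/properP; split; last by exists x; rewrite !inE ?ltnn.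
  by apply/subsetP => z; rewrite !inE; lia.
move=> x y; rewrite arcE /digon_chain.
have [lt_xy|lt_yx|dxy] := ltngtP (d x) (d y).
- by have := block_lt _ _ lt_xy; lia.
- have := block_lt _ _ lt_yx; have : x != y by apply: contraTneq lt_yx => ->; lia.
  lia.
- by rewrite !blockE dxy eqxx ltnn !andbT orbF.
Qed.

End Extremal.
End TriangleFree.

(** * The out-degrees of a digon chain *)

Section LinearOrder.

Variables (C : finType) (le : rel C).
Hypothesis le_lin : linear_order le.

Definition rank (x : C) : nat := #|[set y | (y != x) && le y x]|.

Lemma rank_lt x : rank x < #|C|.
Proof.
rewrite -cardsT; apply: proper_card; apply/properP; split; first exact: subsetT.
by exists x; rewrite !inE ?eqxx.
Qed.

Lemma rank_inj : injective rank.
Proof.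
have [le_refl le_anti le_trans le_total] := le_lin.
have mono x y : x != y -> le x y -> rank x < rank y.
  move=> xy lexy; apply: proper_card; apply/properP; split; last first.
    by exists x; rewrite !inE ?eqxx // xy.
  apply/subsetP => z; rewrite !inE => /andP[_ lezx].
  rewrite (le_trans _ _ _ lezx lexy) andbT.
  by apply: contraNneq xy => zy; rewrite (le_anti x y) // lexy -zy.
move=> x y rxy; apply/eqP/negPn/negP => xy.
have [/(mono _ _ xy)|] := orP (le_total x y); first by rewrite rxy ltnn.
by rewrite eq_sym in xy => /(mono _ _ xy); rewrite rxy ltnn.
Qed.

Definition ord_rank (x : C) : 'I_#|C| := Ordinal (rank_lt x).

Lemma ord_rank_bij : bijective ord_rank.
Proof.
by apply: inj_card_bij; [move=> x y [/rank_inj] | rewrite card_ord].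
Qed.

Lemma sum_rank (F : nat -> nat) : \sum_x F (rank x) = \sum_(i < #|C|) F i.
Proof. by rewrite (reindex ord_rank) //; exact: onW_bij ord_rank_bij. Qed.

Lemma card_rank_lt k : k <= #|C| -> #|[set x | rank x < k]| = k.
Proof.
move=> kC; rewrite card_bool_sum (sum_rank (fun i => i < k)).
transitivity (\sum_(i < #|C| | i < k) 1).
  by rewrite [RHS]big_mkcond; apply: eq_bigr => i _; case: (_ < _).
by rewrite -(big_ord_widen _ (fun=> 1) kC) sum1_card card_ord.
Qed.

(** Arcs never lead to an earlier block, so a triangle would need three distinct ranks with the same
    half. *)
Lemma digon_chain_free : triangle_free (digon_chain le).
Proof.
have neq_rank x y : x != y -> rank x <> rank y.
  by move=> /eqP xy /rank_inj.
move=> x y z; rewrite /digon_chain /block -!/(rank _).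
have := neq_rank x y; have := neq_rank y z; have := neq_rank z x.
case: (x != y); case: (y != z); case: (z != x); lia.
Qed.

Lemma digon_chain_outdeg x :
  outdeg (digon_chain le) x = #|C|.-1 - 2 * (rank x)./2.
Proof.
(* The non-neighbors are [x] itself and the vertices of earlier blocks. *)
have C1 : ~: [set y | digon_chain le x y] =
    x |: [set y | rank y < 2 * (rank x)./2].
  apply/setP => y; rewrite !inE /digon_chain /block -!/(rank _) (eq_sym y).
  have [<-|xy] := eqVneq x y; rewrite ?ltnn //=; lia.
have := cardsC [set y | digon_chain le x y]; rewrite C1 cardsU1 inE.
rewrite card_rank_lt /outdeg; have := rank_lt x; lia.
Qed.

Lemma sum_digon_chain_outdeg :
  \sum_x outdeg (digon_chain le) x ^ 2 = extremal_number #|C|.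
Proof.
under eq_bigr => x _ do rewrite digon_chain_outdeg.
rewrite (sum_rank (fun i => (#|C|.-1 - 2 * i./2) ^ 2)).
have [n] := ubnP #|C|; elim: n #|C| => // n IHn [|[|m]] ltmn.
- by rewrite big_ord0.
- by rewrite big_ord_recl big_ord0.
(* Peel off the first block, whose two vertices have out-degree m + 1. *)
have -> : \sum_(i < m.+2) (m.+2.-1 - 2 * i./2) ^ 2 =
    2 * m.+1 ^ 2 + \sum_(i < m) (m.-1 - 2 * i./2) ^ 2.
  rewrite 2!big_ord_recl /= subn0 addnA addnn -mul2n; congr (_ + _).
  by apply: eq_bigr => i _; congr (_ ^ 2); rewrite /bump /=; lia.
rewrite IHn; last by lia.
apply/eqP; rewrite -(eqn_pmul2r (isT : 0 < 3)) /extremal_number !mulnDl.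
rewrite !divnK ?dvdn3_extremal // -!mulnn; apply/eqP.
have : m * (m * m - 1) + m = m * m * m by rewrite mulnBr; nia.
have : m.+2 * (m.+2 * m.+2 - 1) = m * m * m + 6 * (m * m) + 11 * m + 6.
  by rewrite mulnBr; nia.
lia.
Qed.

End LinearOrder.

(** * From palettes to digraphs *)

Section Palette.

Variables (C : finType) (P : palette C).

(** Both digraphs point away from the middle color, so that triples become pairs of out-arcs. *)
Definition left_arc : rel C := fun y x => [exists z, (x, y, z) \in P].

Definition right_arc : rel C := fun y z => [exists x, (x, y, z) \in P].

Lemma triangle_free_hom (e : rel C) :
  triangle_free e <-> ~ exists g : 'I_3 -> C, forall i, e (g i) (g (ordS i)).
Proof.
split=> [e_free [g eg]|noHom x y z exy eyz ezx].
  apply: (e_free (g ord0) (g (ordS ord0)) (g (ordS (ordS ord0)))) => //.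
  by have := eg (ordS (ordS ord0)); congr (e _ (g _)); exact: val_inj.
apply: noHom; exists (fun i : 'I_3 => nth x [:: x; y; z] i).
by case=> [[|[|[|//]]] i3]; [exact: exy | exact: eyz | exact: ezx].
Qed.

Lemma avoids_L : ~ palette_le P_L P <-> triangle_free left_arc.
Proof.
(* A triple (u, v, c_{uv}) yields the left arc from v to u, so the triangle is reversed. *)
have -> : triangle_free left_arc <-> triangle_free (fun x y => left_arc y x).
  by split=> e_free x y z xy yz zx; exact: (e_free _ _ _ yz xy zx).
rewrite triangle_free_hom; split=> no [f Hf]; apply: no; last first.
  exists (fun i => f (inl i)) => i; apply/existsP.
  pose a : C3_arcs := exist _ (i, ordS i) (eqxx _).
  by exists (f (inr a)); apply: Hf; apply/imsetP; exists a.
(* The color c_{uv} goes to any color completing the arc; [Hf] excludes the default [f ord0]. *)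
exists (fun c => match c with
  | inl i => f i
  | inr a => odflt (f ord0) [pick z | (f (val a).1, f (val a).2, z) \in P]
  end) => x y z /imsetP[a _ [-> -> ->]].
case: pickP => //= noz; have /existsP[w] := Hf (val a).1.
rewrite -(eqP (valP a)). by rewrite [_ \in P]noz.
Qed.

Lemma avoids_R : ~ palette_le P_R P <-> triangle_free right_arc.
Proof.
rewrite triangle_free_hom; split=> no [f Hf]; apply: no; last first.
  exists (fun i => f (inl i)) => i; apply/existsP.
  pose a : C3_arcs := exist _ (i, ordS i) (eqxx _).
  by exists (f (inr a)); apply: Hf; apply/imsetP; exists a.
exists (fun c => match c with
  | inl i => f i
  | inr a => odflt (f ord0) [pick x | (x, f (val a).1, f (val a).2) \in P]
  end) => x y z /imsetP[a _ [-> -> ->]].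
case: pickP => //= nox; have /existsP[w] := Hf (val a).1.
rewrite -(eqP (valP a)). by rewrite [_ \in P]nox.
Qed.

(** For a fixed middle color the two ends vary independently. *)
Lemma card_cherries (e e' : rel C) :
  #|[set t : C * C * C | let: (x, y, z) := t in e y x && e' y z]| =
  \sum_y outdeg e y * outdeg e' y.
Proof.
rewrite card_bool_sum.
rewrite (eq_bigr (fun t => (e t.1.2 t.1.1 && e' t.1.2 t.2) : nat)); last first.
  by case=> [[]].
rewrite -(pair_bigA _ (fun p z => (e p.2 p.1 && e' p.2 z) : nat)) /=.
rewrite -(pair_bigA _ (fun x y => \sum_z (e y x && e' y z))) /=.
rewrite exchange_big; apply: eq_bigr => y _ /=.
rewrite /outdeg !card_bool_sum big_distrlr; apply: eq_bigr => x _ /=.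
by apply: eq_bigr => z _; case: (e y x); case: (e' y z).
Qed.

Hypothesis P_avoids : avoids_LR P.

Let L_free : triangle_free left_arc.
Proof. by apply/avoids_L; case: P_avoids. Qed.

Let R_free : triangle_free right_arc.
Proof. by apply/avoids_R; case: P_avoids. Qed.

Let a := outdeg left_arc.
Let b := outdeg right_arc.

(** The largest palette with the same left and right arcs as [P]. *)
Let hull : palette C :=
  [set t | let: (x, y, z) := t in left_arc y x && right_arc y z].

Let sub_hull : P \subset hull.
Proof.
apply/subsetP => -[[x y] z] Pxyz; rewrite inE.
by apply/andP; split; apply/existsP; [exists z | exists x].
Qed.

Let AMGM y : 2 * (a y * b y) <= a y ^ 2 + b y ^ 2.
Proof. exact: nat_Cauchy. Qed.

Let sum_sq : \sum_y (a y ^ 2 + b y ^ 2) <= 2 * extremal_number #|C|.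
Proof. by rewrite big_split mul2n -addnn leq_add // sum_outdeg_sq_le. Qed.

Lemma card_palette_le : #|P| <= extremal_number #|C|.
Proof.
apply: leq_trans (subset_leq_card sub_hull) _.
rewrite card_cherries -(leq_pmul2l (isT : 0 < 2)) (leq_trans _ sum_sq) //.
by rewrite big_distrr leq_sum.
Qed.

Lemma extremal_palette : #|P| = extremal_number #|C| ->
  exists J, ordered_digon_chain J /\ P = Pstar J.
Proof.
move=> cP.
have cH : extremal_number #|C| <= \sum_y a y * b y.
  by rewrite -cP -card_cherries subset_leq_card.
have AMGM_sum : \sum_y 2 * (a y * b y) <= \sum_y (a y ^ 2 + b y ^ 2).
  by apply: leq_sum.
have tight : \sum_y (a y ^ 2 + b y ^ 2) <= \sum_y 2 * (a y * b y).
  by rewrite -big_distrr (leq_trans sum_sq) // leq_mul2l cH orbT.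
(* Equality in the summed AM-GM inequality holds termwise. *)
have ab y : a y = b y.
  have [_ eq_ab] := nat_Cauchy (a y) (b y); apply/eqP; rewrite -eq_ab.
  exact/eqP/(sum_leq_eq AMGM tight).
have sum_a : \sum_y a y ^ 2 = extremal_number #|C|.
  apply/eqP; rewrite eqn_leq sum_outdeg_sq_le //= (leq_trans cH) // leq_sum //.
  by move=> y _; rewrite -ab mulnn.
have sum_b : \sum_y b y ^ 2 = extremal_number #|C|.
  by rewrite -sum_a; apply: eq_bigr => y _; rewrite ab.
exists left_arc; split; first exact: extremal_digon_chain.
have -> : P = hull.
  apply/eqP; rewrite eqEcard sub_hull card_cherries cP.
  rewrite -sum_a leq_sum // => y _; rewrite -[outdeg right_arc y]ab.
  by rewrite mulnn.
(* Each arc relation is determined by its out-degrees, so [ab] identifies the two. *)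
apply/setP => -[[x y] z]; rewrite !inE (arcE R_free sum_b) (arcE L_free sum_a).
by rewrite (arcE L_free sum_a) -/a -/b !ab.
Qed.

End Palette.

(** * Palettes of digon chains and the final theorem *)

Lemma triangle_free_sub (C : finType) (e e' : rel C) :
  subrel e e' -> triangle_free e' -> triangle_free e.
Proof.
by move=> ee' e'_free x y z /ee' xy /ee' yz /ee' zx; exact: e'_free xy yz zx.
Qed.

Lemma Pstar_avoids (C : finType) (J : rel C) :
  ordered_digon_chain J -> avoids_LR (Pstar J).
Proof.
case=> le le_lin JE; have free := digon_chain_free le_lin.
split; [apply/avoids_L | apply/avoids_R]; apply: triangle_free_sub free => x y;
  by case/existsP => z; rewrite inE !JE => /andP[].
Qed.

Lemma card_Pstar (C : finType) (J : rel C) :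
  ordered_digon_chain J -> #|Pstar J| = extremal_number #|C|.
Proof.
case=> le le_lin JE; rewrite card_cherries -(sum_digon_chain_outdeg le_lin).
apply: eq_bigr => x _; rewrite mulnn; congr (_ ^ 2).
by apply: eq_card => y; rewrite !inE JE.
Qed.

Lemma leq_ord_linear m : linear_order (fun i j : 'I_m => i <= j).
Proof.
split=> [i|i j|j i k|i j]; [exact: leqnn | | exact: leq_trans | exact: leq_total].
by move=> ij; apply/val_inj/eqP; rewrite eqn_leq.
Qed.

Lemma F2_digon_chain m : ordered_digon_chain (@F2 m).
Proof. by exists (fun i j : 'I_m => i <= j) => //; exact: leq_ord_linear. Qed.

Lemma block_ord m (i : 'I_m) : block (fun i j : 'I_m => i <= j) i = i./2.
Proof.
congr half; transitivity (\sum_(j < m | j < i) 1).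
  by rewrite -sum1_card; apply: eq_bigl => j; rewrite inE ltn_neqAle.
by rewrite -(big_ord_widen _ (fun=> 1) (ltnW (ltn_ord i))) sum1_card card_ord.
Qed.

(** Sending each color to its position preserves blocks, as position i lies in block [i./2] on both
    sides. *)
Lemma Pstar_iso (C : finType) (J : rel C) :
  ordered_digon_chain J -> palette_iso (Pstar J) (Pmstar #|C|).
Proof.
case=> le le_lin JE; exists (ord_rank le); first exact: ord_rank_bij.
have JF x y : J x y = F2 (ord_rank le x) (ord_rank le y).
  rewrite JE /F2 /digon_chain !block_ord /=; congr ((~~ _ && _) || _).
  by rewrite -val_eqE /= (inj_eq (rank_inj le_lin)).
by move=> x y z; rewrite !inE !JF.
Qed.

Theorem corollary6p5 (m : nat) (hm : 1 <= m) :
  (forall (C : finType) (P : palette C),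
     #|C| = m -> ~ palette_le P_L P -> ~ palette_le P_R P ->
     (#|P| = extremal_number m <->
      exists J : rel C, ordered_digon_chain J /\ P = Pstar J))
  /\
  [/\ extremal m (Pmstar m),
      #|Pmstar m| = extremal_number m &
      forall (C : finType) (P : palette C),
        extremal m P -> palette_iso P (Pmstar m)].
Proof.
have cPm : #|Pmstar m| = extremal_number m.
  by rewrite card_Pstar ?card_ord //; exact: F2_digon_chain.
have Pm_avoids : avoids_LR (Pmstar m) by apply/Pstar_avoids/F2_digon_chain.
split=> [C P <- nL nR|]; first split=> [cP|[J [chain ->]]].
- exact: (extremal_palette (conj nL nR)).
- exact: card_Pstar.
split=> // [|C P [cC P_avoids P_max]].
  split=> // [|C P cC P_avoids]; first exact: card_ord.
  by rewrite cPm -cC card_palette_le.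
(* The lower bound compares [P] with the competitor [Pmstar m]. *)
have cP : #|P| = extremal_number #|C|.
  apply/eqP; rewrite eqn_leq card_palette_le // cC -cPm P_max //.
  exact: card_ord.
have [J [chain ->]] := extremal_palette P_avoids cP.
by rewrite -cC; exact: Pstar_iso.
Qed.
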